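(* Let $\mathcal{L}\subseteq\mathrm{Lin}$ be nonempty, downward $\preceq$-closed and ccs. If either $\boldsymbol{\omega}^*\in\mathcal{L}$ or $\boldsymbol{\omega}\in\mathcal{L}$, then $\{\boldsymbol{\omega},\boldsymbol{\omega}^*\}$ is a basis for $\trianglelefteq^{\mathcal{L}}_{\mathrm{LO}}$.
   Context: Linear orders are reflexive and nonempty. $L\preceq L'$ means there is an embedding $f:L\to L'$, i.e. $x\le_L y\iff f(x)\le_{L'}f(y)$. $\mathrm{LO}\subseteq 2^{\mathbb{N}\times\mathbb{N}}$ is the set of (codes for) linear orders with domain $\mathbb{N}$; $\mathrm{Fin}$ is the set of (codes for) nonempty linear orders on finite subsets of $\mathbb{N}$; $\mathrm{Lin}=\mathrm{Fin}\cup\mathrm{LO}$. $\boldsymbol{\omega}\in\mathrm{LO}$ is a copy of $(\mathbb{N},\le)$ and $\boldsymbol{\omega}^*$ is its reverse. A class $\mathcal{L}\subseteq\mathrm{Lin}$ is downward $\preceq$-closed if $K\in\mathrm{Lin}$ and $K\preceq L\in\mathcal{L}$ imply $K\in\mathcal{L}$; membership in $\mathcal{L}$ is meant up to isomorphism. A subset $I$ of a linear order $L$ is convex if $x\le_L y\le_L z$ and $x,z\in I$ imply $y\in I$. For $A,B\subseteq L$ write $A\le_L B$ (resp. $A<_L B$) if $a\le_L b$ (resp. $a<_L b$) for all $a\in A$, $b\in B$. A $K$-convex partition of $L$ is a partition $(L_k)_{k\in K}$ of $L$ (into nonempty sets) such that $k<_K k'\iff L_k<_L L_{k'}$. The relation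 $L\trianglelefteq^{\mathcal{L}}L'$ holds iff there are $K\in\mathcal{L}$, a $K$-convex partition $(L_k)_{k\in K}$ of $L$, and an embedding $f$ of $L$ into $L'$ such that $f(L_k)$ is a convex subset of $L'$ for every $k\in K$. $\trianglelefteq^{\mathcal{L}}_{\mathrm{LO}}$ is its restriction to $\mathrm{LO}$. $\mathcal{L}$ is ccs (closed under convex sums) if for all $K,K'\in\mathcal{L}$ and every family $(K'_k)_{k\in K}$ of nonempty convex subsets of $K'$ such that $k_0<_K k_1\Rightarrow K'_{k_0}\le_{K'}K'_{k_1}$, we have $\sum_{k\in K}K'_k\in\mathcal{L}$, where $\sum_{k\in K}K'_k=\{(x,k): k\in K, x\in K'_k\}$ ordered antilexicographically. When $\mathcal{L}$ is ccs, $\trianglelefteq^{\mathcal{L}}$ is a quasi-order. A set $\mathcal{B}\subseteq X$ is a basis for a quasi-order $\precsim$ on $X$ if for every $x\in X$ there is $b\in\mathcal{B}$ with $b\precsim x$. *)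

(* Defs.v *)
From mathcomp Require Import all_boot.
From mathcomp Require Import boolp classical_sets cardinality.

Set Implicit Arguments.
Unset Strict Implicit.
Unset Printing Implicit Defensive.

Local Open Scope classical_set_scope.

(* A linear order on a subset of [T] is coded by its reflexive order relation
   on [T]; its underlying set is then recovered as the reflexive points. *)
Definition dom (T : Type) (L : rel T) : set T := [set x | L x x].

Definition linear_order (T : Type) (L : rel T) : Prop :=
  [/\ dom L !=set0,
      forall x y, L x y -> dom L x /\ dom L y,
      transitive L,
      antisymmetric L
    & {in dom L &, total L}].

Definition strict (T : eqType) (L : rel T) : rel T :=
  fun x y => (x != y) && L x y.

Definition LO : set (rel nat) := [set L | linear_order L /\ dom L = setT].

Definition Fin : set (rel nat) :=
  [set L | linear_order L /\ finite_set (dom L)].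

Definition Lin : set (rel nat) := Fin `|` LO.

Definition omega : rel nat := fun m n => m <= n.

Definition omega_star : rel nat := fun m n => n <= m.

Definition embedding (T T' : Type) (L : rel T) (L' : rel T') (f : T -> T') :
    Prop :=
  f @` dom L `<=` dom L' /\
  {in dom L &, {mono f : x y / L x y >-> L' x y}}.

Definition embeds (T T' : Type) (L : rel T) (L' : rel T') : Prop :=
  exists f : T -> T', embedding L L' f.

(* Embeddings of linear orders are injective on the domain, by antisymmetry,
   so only surjectivity has to be added. *)
Definition isomorphic (T T' : Type) (L : rel T) (L' : rel T') : Prop :=
  exists f : T -> T', embedding L L' f /\ f @` dom L = dom L'.

Definition convex_subset (T : Type) (L : rel T) (I : set T) : Prop :=
  I `<=` dom L /\
  forall x y z, L x y -> L y z -> I x -> I z -> I y.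

Definition set_rel (T : Type) (R : rel T) (A B : set T) : Prop :=
  forall a b, A a -> B b -> R a b.

Definition convex_partition (T I : eqType) (K : rel I) (L : rel T)
    (P : I -> set T) : Prop :=
  partition (dom K) P (dom L) /\
  forall k k', dom K k -> dom K k' ->
    (strict K k k' <-> set_rel (strict L) (P k) (P k')).

Definition pw_convex_embeds (LL : set (rel nat)) (L L' : rel nat) : Prop :=
  exists (K : rel nat) (P : nat -> set nat) (f : nat -> nat),
    [/\ LL K, convex_partition K L P, embedding L L' f
      & forall k, dom K k -> convex_subset L' (f @` P k)].

Definition downward_closed (LL : set (rel nat)) : Prop :=
  forall K L, Lin K -> LL L -> embeds K L -> LL K.

(* A pair (x, k) is in the domain iff k is in K and x is in A k. *)
Definition convex_sum (I T : eqType) (K : rel I) (K' : rel T)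
    (A : I -> set T) : rel (T * I) :=
  fun p q =>
    [&& p.2 \in dom K, p.1 \in A p.2, q.2 \in dom K, q.1 \in A q.2
      & strict K p.2 q.2 || ((p.2 == q.2) && K' p.1 q.1)].

(* The sum lives on pairs, so its membership in [LL] is up to isomorphism. *)
Definition ccs (LL : set (rel nat)) : Prop :=
  forall (K K' : rel nat) (A : nat -> set nat),
    LL K -> LL K' ->
    (forall k, dom K k -> A k !=set0 /\ convex_subset K' (A k)) ->
    (forall k0 k1, dom K k0 -> dom K k1 -> strict K k0 k1 ->
      set_rel K' (A k0) (A k1)) ->
    exists2 M : rel nat, LL M & isomorphic M (convex_sum K K' A).

Definition is_basis (T : Type) (X : set T) (R : T -> T -> Prop) (B : set T) :
    Prop :=
  B `<=` X /\ forall x, X x -> exists2 b, B b & R b x.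

(* Main.v *)
Require Import Defs.
From mathcomp Require Import all_boot.
From mathcomp Require Import boolp classical_sets cardinality.

(** Any infinite linear order [L] contains a copy of [omega], or else every
    nonempty subset of [L] has a maximum; in the latter case, picking the
    successive maxima of what remains yields a final segment of [L] of type
    [omega_star].  Dually, [L] contains a copy of [omega_star] or has an initial
    segment of type [omega].  When [omega] belongs to [LL], a copy of [omega]
    inside [L] is a piecewise convex one, via the partition into singletons
    ([pw_convex_embeds_singletons]), and a final segment of type [omega_star]
    is one via the partition with a single block
    ([pw_convex_embeds_one_block]), since downward closure puts the one-point
    order in [LL].  The case of [omega_star] is dual. *)

Local Open Scope classical_set_scope.

(** The linear order with the single point [0]. *)
Definition one_point : rel nat := fun x y => (x == 0) && (y == 0).

(** The reverse order, with the same underlying set. *)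
Definition reverse {T : Type} (L : rel T) : rel T := fun x y => L y x.

Lemma in_domE {T : Type} (L : rel T) (x : T) : (x \in dom L) = L x x.
Proof. by rewrite -[RHS]asboolb. Qed.

Lemma linear_order_reverse {T : Type} {L : rel T} :
  linear_order L -> linear_order (reverse L).
Proof.
case=> L0 Ldom Ltr Lanti Ltot; split=> //.
- by move=> x y /Ldom [].
- by move=> y x z Lyx Lzy; exact: Ltr Lzy Lyx.
- by move=> x y; rewrite andbC; exact: Lanti.
- by move=> x y Dx Dy; exact: Ltot.
Qed.

Lemma embedding_reverse {T T' : Type} (L : rel T) (L' : rel T') (f : T -> T') :
  embedding L L' f -> embedding (reverse L) (reverse L') f.
Proof. by case=> im mn; split=> // x y Dx Dy; exact: mn. Qed.

Lemma convex_subset_reverse {T : Type} (L : rel T) (I : set T) :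
  convex_subset (reverse L) I -> convex_subset L I.
Proof.
by case=> sub cv; split=> // x y z Lxy Lyz Ix Iz; exact: (cv z y x).
Qed.

Lemma omega_LO : LO omega.
Proof.
have Ddom : dom omega = setT by apply/seteqP; split=> // x _; exact: leqnn.
split=> //; split.
- by exists 0.
- by rewrite Ddom.
- exact: leq_trans.
- exact: anti_leq.
- by move=> x y _ _; exact: leq_total.
Qed.

Lemma omega_star_LO : LO omega_star.
Proof.
case: omega_LO => lo Ddom; split; last exact: Ddom.
exact: linear_order_reverse lo.
Qed.

Lemma one_point_mem (LL : set (rel nat)) :
  LL !=set0 -> LL `<=` Lin -> downward_closed LL -> LL one_point.
Proof.
move=> [L LLL] LLLin dcl.
have [a La] : dom L !=set0 by case: (LLLin L LLL) => [[[]]|[[]]].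
have Ddom : dom one_point = [set 0].
  by apply/seteqP; split=> [x /andP[/eqP]|x ->].
apply: dcl LLL _.
- left; split; last by rewrite Ddom; exact: finite_set1.
  split.
  + by exists 0.
  + by move=> x y /andP[/eqP -> /eqP ->].
  + by move=> y x z /andP[x0 _] /andP[_ z0]; exact/andP.
  + by move=> x y /andP[/andP[/eqP -> /eqP ->]].
  + by move=> x y; rewrite !in_domE => /andP[/eqP -> _] /andP[/eqP -> _].
- exists (fun=> a); split=> [_ [x _ <-] //|x y].
  by rewrite !in_domE => /andP[/eqP -> _] /andP[/eqP -> _]; exact: La.
Qed.

Lemma pw_convex_embeds_singletons (LL : set (rel nat)) (L L' : rel nat)
    (f : nat -> nat) :
  LL L -> linear_order L' -> embedding L L' f -> pw_convex_embeds LL L L'.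
Proof.
move=> LLL [_ _ _ anti' _] emb.
exists L, (fun k => [set k]), f; split=> //.
- split; [split|].
  + by apply/seteqP; split=> [x [k Dk ->] //|x Dx]; exists x.
  + by move=> i j _ _ [x [/= <- <-]].
  + by move=> i _; exists i.
  + by move=> k k' _ _; split=> [Kkk' _ _ -> -> //|]; apply.
- move=> k Dk; rewrite image_set1; split=> [_ ->|x y z L1 L2 xE zE].
    by case: emb => im _; apply: im; exists k.
  by apply/esym/anti'; rewrite -{1}xE -zE L1 L2.
Qed.

Lemma pw_convex_embeds_one_block (LL : set (rel nat)) (L L' : rel nat)
    (f : nat -> nat) :
  LL one_point -> dom L !=set0 -> embedding L L' f ->
  convex_subset L' (f @` dom L) -> pw_convex_embeds LL L L'.
Proof.
move=> LL1 [a La] emb cv.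
exists one_point, (fun=> dom L), f; split=> //.
split; [split|].
- by apply/seteqP; split=> [x [] //|x Dx]; exists 0.
- by move=> i j /andP[/eqP -> _] /andP[/eqP -> _].
- by move=> i _; exists a.
- move=> k k' /andP[/eqP -> _] /andP[/eqP -> _]; split=> // lt.
  by have := lt a a La La; rewrite /strict eqxx.
Qed.

(** A nonempty subset without maximum contains an increasing sequence. *)
Lemma omega_embedding {T : eqType} {L : rel T} (A : set T) :
  linear_order L -> A `<=` dom L -> A !=set0 ->
  (forall m, A m -> exists2 x, A x & ~~ L x m) ->
  exists f, embedding omega L f.
Proof.
move=> [_ Ldom Ltr Lanti Ltot] AL [a Aa] nomax.
(* Outside [A], the value of [next] is irrelevant. *)
have /choice[next nextP] x : exists y, A x -> A y /\ ~~ L y x.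
  have [/nomax[y Ay nL]|nA] := pselect (A x); first by exists y.
  by exists x.
pose f n := iter n next a.
have Af n : A (f n) by elim: n => //= n /nextP[].
have Lff n : L (f n) (f n) by exact: AL.
have step n : L (f n) (f n.+1) /\ ~~ L (f n.+1) (f n).
  have [Ay nL] := nextP _ (Af n); split=> //.
  have /orP[//|] : L (f n) (f n.+1) || L (f n.+1) (f n).
    by apply: Ltot; rewrite in_domE; exact: Lff.
  by rewrite (negbTE nL).
have mono m n : m <= n -> L (f m) (f n).
  move=> /subnK <-; elim: (n - m) => [|k IH]; first exact: Lff.
  by apply: Ltr IH _; case: (step (k + m)).
exists f; split=> [_ [n _ <-]|m n _ _]; first exact: Lff.
rewrite /omega; case: (leqP m n) => [/mono //|ltnm].
apply: contraNF (proj2 (step n)) => Lmn.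
exact: Ltr (mono _ _ ltnm) Lmn.
Qed.

(** If every nonempty subset has a maximum, the sequence of successive maxima
    enumerates a final segment in decreasing order. *)
Lemma omega_star_convex_embedding {T : eqType} {L : rel T} :
  linear_order L -> infinite_set (dom L) ->
  (forall A : set T, A `<=` dom L -> A !=set0 ->
    exists2 m, A m & forall x, A x -> L x m) ->
  exists2 f, embedding omega_star L f & convex_subset L (f @` dom omega_star).
Proof.
move=> [_ Ldom Ltr Lanti _] Linf maxP.
pose rest (s : seq T) : set T := [set x | L x x /\ x \notin s].
have /choice[top topP] s : exists m, rest s m /\ forall x, rest s x -> L x m.
  have [||m] := maxP (rest s); [by move=> x []| |by exists m].
  apply: contrapT => rest0; apply: Linf.
  apply: sub_finite_set (finite_seq s) => x Lx.
  by apply: contrapT => /negP xs; apply: rest0; exists x.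
(* [s n] lists the first [n] maxima picked, and [f n] is the next one. *)
pose s n := iter n (fun s => top s :: s) [::].
pose f n := top (s n).
have Lff n : L (f n) (f n) by case: (topP (s n)) => [[]].
have sP x n : reflect (exists2 k, k < n & f k = x) (x \in s n).
  elim: n => [|n IH]; first by apply: (iffP idP) => // -[].
  rewrite /= inE; apply: (iffP orP).
    case=> [/eqP ->|/IH[k ltkn <-]]; first by exists n.
    by exists k => //; exact: ltnW.
  case=> k; rewrite ltnS leq_eqVlt => /orP[/eqP -> <-|ltkn fk].
    by left; exact: eqxx.
  by right; apply/IH; exists k.
have fresh n k : k < n -> f k != f n.
  move=> ltkn; case: (topP (s n)) => -[_ nin] _.
  by apply: contraNneq nin => E; apply/sP; exists k.
have below n x : L x x -> x \notin s n -> L x (f n).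
  by move=> Lx xs; apply: (proj2 (topP (s n))).
have anti m n : m <= n -> L (f n) (f m).
  move=> lemn; apply: below (Lff n) _; apply/sP => -[k ltkm] /eqP.
  exact/negP/fresh/(leq_trans ltkm).
exists f; [split=> [_ [n _ <-]|m n _ _]; first exact: Lff|split].
- rewrite /omega_star; case: (leqP n m) => [/anti //|ltmn].
  apply: contraNF (fresh _ _ ltmn) => Lmn.
  by apply/eqP/Lanti; rewrite Lmn anti // ltnW.
- by move=> _ [n _ <-]; exact: Lff.
(* A point above [f n] either was picked before stage [n], or is at most the
   maximum [f n] of what remains. *)
- move=> x y z Lny _ [n _ fn] _; rewrite -{}fn in Lny.
  have [/sP[k _ <-]|yn] := boolP (y \in s n).
    by exists k => //; exact: leqnn.
  exists n; first exact: leqnn.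
  by apply: Lanti; rewrite Lny below //; case: (Ldom _ _ Lny).
Qed.

Lemma omega_or_omega_star_convex {T : eqType} {L : rel T} :
  linear_order L -> infinite_set (dom L) ->
  (exists f, embedding omega L f) \/
  (exists2 f, embedding omega_star L f
            & convex_subset L (f @` dom omega_star)).
Proof.
move=> lo Linf.
have [[A [AL A0 nomax]]|hmax] := pselect (exists A : set T,
    [/\ A `<=` dom L, A !=set0 & forall m, A m -> exists2 x, A x & ~~ L x m]).
  by left; exact: omega_embedding nomax.
right; apply: omega_star_convex_embedding => // A AL A0.
apply: contrapT => nomax; apply: hmax; exists A; split=> // m Am.
apply: contrapT => nx; apply: nomax; exists m => // x Ax.
by apply: contrapT => /negP nL; apply: nx; exists x.
Qed.

Lemma omega_star_or_omega_convex {T : eqType} {L : rel T} :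
  linear_order L -> infinite_set (dom L) ->
  (exists f, embedding omega_star L f) \/
  (exists2 f, embedding omega L f & convex_subset L (f @` dom omega)).
Proof.
move=> lo Linf.
case: (omega_or_omega_star_convex (linear_order_reverse lo) Linf).
  by case=> f /embedding_reverse emb; left; exists f.
case=> f /embedding_reverse emb cv; right; exists f => //.
exact: convex_subset_reverse cv.
Qed.

Theorem theorem5p4 (LL : set (rel nat)) :
  LL `<=` Lin ->
  LL !=set0 ->
  downward_closed LL ->
  ccs LL ->
  LL omega_star \/ LL omega ->
  is_basis LO (pw_convex_embeds LL) [set omega; omega_star].
Proof.
move=> LLLin LL0 dcl _ LLomega.
have LL1 := one_point_mem _ LL0 LLLin dcl.
split=> [_ [->|->]|L [lo domL]]; [exact: omega_LO|exact: omega_star_LO|].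
have Linf : infinite_set (dom L) by rewrite domL; exact: infinite_nat.
case: LLomega => LLo.
- have [[f emb]|[f emb cv]] := omega_star_or_omega_convex lo Linf.
    by exists omega_star; [right|exact: pw_convex_embeds_singletons emb].
  exists omega; first by left.
  by apply: pw_convex_embeds_one_block emb cv => //; exists 0.
- have [[f emb]|[f emb cv]] := omega_or_omega_star_convex lo Linf.
    by exists omega; [left|exact: pw_convex_embeds_singletons emb].
  exists omega_star; first by right.
  by apply: pw_convex_embeds_one_block emb cv => //; exists 0.
Qed.
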